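(* Let $M$ be an overt commutative localic monoid. If the frame $\mathscr{S}M$ of saturated opens of $M$ is dualisable as a suplattice (i.e. in the symmetric monoidal category $\mathbf{Sup}$), then the suplattice $\mathscr{M}M$ of monoid ideals of $M$ is its dual.
   Context: Everything is constructive. $\Omega$ is the frame of truth values. $\mathbf{Sup}$ is the category of suplattices (posets with arbitrary joins, join-preserving maps), symmetric monoidal closed with tensor $\otimes$ (classifying maps preserving joins in each variable), unit $\Omega$, and internal hom $\hom(-,-)$ ordered pointwise; $\Delta\colon\Omega\otimes\Omega\cong\Omega$. For a locale $X$, $\mathcal{O}X$ is its frame of opens; the frame coproduct $\oplus$ has underlying suplattice $\otimes$. $X$ is overt if $\mathcal{O}X$ has a base of positive elements ($a$ is positive if $a\le\bigvee I$ implies $I$ is inhabited). For a commutative localic monoid $M$ (commutative monoid object in locales), $\epsilon_1\colon\mathcal{O}M\to\Omega$ and $\mu_\times\colon\mathcal{O}M\to\mathcal{O}M\oplus\mathcal{O}M$ are the frame maps corresponding to unit and multiplication, and $\iota_1,\iota_2$ the coproduct injections $\mathcal{O}M\to\mathcal{O}M\oplus\mathcal{O}M$. Saturated opens: $\mathscr{S}M=\{s\in\mathcal{O}M\mid\mu_\times(s)\le\iota_1(s)\}$. Overt weakly closed sublocales of $M$ are identified with elements of $\hom(\mathcal{O}M,\Omega)$, which is a quantale under $f\cdot g=\Delta(f\otimes g)\mu_\times$ with unit $\epsilon_1$. A monoid ideal is $I\in\hom(\mathcal{O}M,\Omega)$ with $I=I\cdot\top$; $\mathscr{M}M$ is the set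 of monoid ideals with the pointwise order, i.e. the quotient of $\hom(\mathcal{O}M,\Omega)$ by the nucleus $W\mapsto W\cdot\top$. *)

(* Defs.v *)
From Stdlib Require Import FunctionalExtensionality PropExtensionality.

Set Implicit Arguments.
Unset Strict Implicit.
Unset Printing Implicit Defensive.

(* Truth values are the elements of [Prop] and the power set of [A] is
   [A -> Prop].  Excluded middle is not used: the only axioms are function and
   propositional extensionality, which make Leibniz equality the right equality
   on power sets and on sets of maps. *)

Definition image (A B : Type) (f : A -> B) (S : A -> Prop) : B -> Prop :=
  fun y => exists x, S x /\ f x = y.

Record Sup : Type := MkSup {
  car :> Type;
  le : car -> car -> Prop;
  le_refl : forall x, le x x;
  le_trans : forall x y z, le x y -> le y z -> le x z;
  le_antisym : forall x y, le x y -> le y x -> x = y;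
  join : (car -> Prop) -> car;
  join_ub : forall (S : car -> Prop) x, S x -> le x (join S);
  join_least : forall (S : car -> Prop) z, (forall x, S x -> le x z) -> le (join S) z
}.

Declare Scope sup_scope.
Delimit Scope sup_scope with sup.
Open Scope sup_scope.
Notation "x ⊑ y" := (le x y) (at level 70, no associativity) : sup_scope.

Definition top (A : Sup) : A := join (fun _ => True).

Section SupLemmas.
Context {A B : Sup}.

Lemma le_top (x : A) : x ⊑ top A.
Proof. now apply join_ub. Qed.

Lemma join_leE (S : A -> Prop) z : join S ⊑ z <-> (forall x, S x -> x ⊑ z).
Proof.
split; [intros H x Hx | apply join_least].
apply le_trans with (join S); [now apply join_ub | exact H].
Qed.

Lemma join_image_leE (C : Type) (f : C -> A) S z :
  join (image f S) ⊑ z <-> (forall x, S x -> f x ⊑ z).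
Proof.
rewrite join_leE; split.
- intros H x Hx; apply H; now exists x.
- intros H y [x [Hx <-]]; now apply H.
Qed.

Lemma le_ext (x y : A) : (forall z, x ⊑ z <-> y ⊑ z) -> x = y.
Proof. intros H; apply le_antisym; apply H; apply le_refl. Qed.

Lemma join_image_mono (C : Type) (f : C -> A) S x :
  S x -> f x ⊑ join (image f S).
Proof. intros Hx; apply join_ub; now exists x. Qed.

End SupLemmas.

Record Hom (A B : Sup) : Type := MkHom {
  hfun :> A -> B;
  hom_join : forall S, hfun (join S) = join (image hfun S)
}.

Section HomLemmas.
Context {A B : Sup}.

Lemma hom_ext (f g : Hom A B) : (forall x, f x = g x) -> f = g.
Proof.
destruct f as [f Hf], g as [g Hg]; simpl; intros H.
assert (E : f = g) by now apply functional_extensionality.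
destruct E; f_equal; apply proof_irrelevance.
Qed.

Lemma hom_leE (f : Hom A B) S z : f (join S) ⊑ z <-> (forall x, S x -> f x ⊑ z).
Proof. rewrite hom_join; apply join_image_leE. Qed.

Lemma hom_mono (f : Hom A B) x y : x ⊑ y -> f x ⊑ f y.
Proof.
intros H; assert (E : y = join (fun t => t = x \/ t = y)).
{ apply le_antisym; [apply join_ub; now right|].
  apply join_least; intros t [-> | ->]; [exact H | apply le_refl]. }
rewrite E at 1 ; rewrite hom_join; apply join_image_mono; now left.
Qed.

Definition mk_hom (f : A -> B)
    (H : forall S z, f (join S) ⊑ z <-> (forall x, S x -> f x ⊑ z)) : Hom A B :=
  {| hfun := f;
     hom_join := fun S => le_ext (fun z =>
       iff_trans (H S z) (iff_sym (join_image_leE f S z))) |}.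

End HomLemmas.

Definition hom_id (A : Sup) : Hom A A.
Proof. refine (@mk_hom A A (fun x => x) _); intros; apply join_leE. Defined.

Definition hom_comp (A B C : Sup) (g : Hom B C) (f : Hom A B) : Hom A C.
Proof.
refine (@mk_hom A C (fun x => g (f x)) _); intros S z.
rewrite hom_join, hom_leE; split.
- intros H x Hx; apply H; now exists x.
- intros H y [x [Hx <-]]; now apply H.
Defined.

Notation "g ∘ f" := (hom_comp g f) (at level 40, left associativity) : sup_scope.

Definition hom_le (A B : Sup) (f g : Hom A B) : Prop := forall x, f x ⊑ g x.

Definition hom_join_op (A B : Sup) (F : Hom A B -> Prop) : Hom A B.
Proof.
refine (@mk_hom A B (fun x => join (image (fun f : Hom A B => f x) F)) _).
intros S z; rewrite join_image_leE; split.
- intros H x Hx; apply join_image_leE; intros f Hf.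
  exact (proj1 (hom_leE f S z) (H f Hf) x Hx).
- intros H f Hf; apply hom_leE; intros x Hx.
  exact (proj1 (join_image_leE _ _ _) (H x Hx) f Hf).
Defined.

Definition hom_sup (A B : Sup) : Sup.
Proof.
refine (@MkSup (Hom A B) (@hom_le A B) _ _ _ (@hom_join_op A B) _ _).
- intros f x; apply le_refl.
- intros f g h H1 H2 x; exact (le_trans (H1 x) (H2 x)).
- intros f g H1 H2; apply hom_ext; intros x; now apply le_antisym.
- intros F f Hf x; simpl.
  exact (join_image_mono (fun f : Hom A B => f x) Hf).
- intros F g H x; simpl; apply join_image_leE; intros f Hf; exact (H f Hf x).
Defined.

Definition bilinear (A B C : Sup) (f : A -> B -> C) : Prop :=
  (forall S b, f (join S) b = join (image (fun a => f a b) S)) /\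
  (forall a T, f a (join T) = join (image (f a) T)).

Lemma mk_bilinear (A B C : Sup) (f : A -> B -> C) :
  (forall S b z, f (join S) b ⊑ z <-> (forall a, S a -> f a b ⊑ z)) ->
  (forall a T z, f a (join T) ⊑ z <-> (forall b, T b -> f a b ⊑ z)) ->
  bilinear f.
Proof.
intros H1 H2; split.
- intros S b; apply le_ext; intros z; rewrite join_image_leE; apply H1.
- intros a T; apply le_ext; intros z; rewrite join_image_leE; apply H2.
Qed.

(* Elements of the tensor product are the subsets [D] of [A * B] such that
   [(a, join T) \in D] iff [(a, b) \in D] for all [b \in T], and symmetrically
   in the other variable; [D] represents the join of the [a ⊗ b] with
   [(a, b) \in D].  The universal property is proved below
   ([tens_lift_pure], [tens_ext]). *)
Definition closed (A B : Sup) (D : A -> B -> Prop) : Prop :=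
  (forall S b, D (join S) b <-> (forall a, S a -> D a b)) /\
  (forall a T, D a (join T) <-> (forall b, T b -> D a b)).

Record Tens (A B : Sup) : Type := MkTens {
  tset :> A -> B -> Prop;
  tens_closed : closed tset
}.

Section Tensor.
Context {A B : Sup}.

Lemma tset_ext (D E : Tens A B) : (forall a b, D a b <-> E a b) -> D = E.
Proof.
destruct D as [D HD], E as [E HE]; simpl; intros H.
assert (Q : D = E).
{ apply functional_extensionality; intros a.
  apply functional_extensionality; intros b.
  apply propositional_extensionality, H. }
destruct Q; f_equal; apply proof_irrelevance.
Qed.

Definition closure (G : A -> B -> Prop) : Tens A B.
Proof.
refine (@MkTens A B (fun a b => forall E : Tens A B,
  (forall a b, G a b -> E a b) -> E a b) _).
split.
- intros S b; split.
  + intros H a Ha E HE; exact (proj1 (proj1 (tens_closed E) S b) (H E HE) a Ha).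
  + intros H E HE; apply (proj1 (tens_closed E)); intros a Ha; exact (H a Ha E HE).
- intros a T; split.
  + intros H b Hb E HE; exact (proj1 (proj2 (tens_closed E) a T) (H E HE) b Hb).
  + intros H E HE; apply (proj2 (tens_closed E)); intros b Hb; exact (H b Hb E HE).
Defined.

Lemma closure_in (G : A -> B -> Prop) a b : G a b -> closure G a b.
Proof. intros H E HE; now apply HE. Qed.

Lemma closure_min (G : A -> B -> Prop) (E : A -> B -> Prop) :
  closed E -> (forall a b, G a b -> E a b) -> forall a b, closure G a b -> E a b.
Proof. intros HE H a b Hab; exact (Hab (MkTens HE) H). Qed.

Definition tens_sup : Sup.
Proof.
refine (@MkSup (Tens A B) (fun D E => forall a b, D a b -> E a b) _ _ _
  (fun F => closure (fun a b => exists D : Tens A B, F D /\ D a b)) _ _).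
- auto.
- auto.
- intros D E H1 H2; apply tset_ext; split; auto.
- intros F D HD a b H; apply closure_in; now exists D.
- intros F E H; apply closure_min; [apply tens_closed|].
  intros a b [D [HD Hab]]; exact (H D HD a b Hab).
Defined.

End Tensor.

Arguments tens_sup : clear implicits.
Notation "A ⊗ B" := (tens_sup A B) (at level 35, right associativity) : sup_scope.

Definition pure (A B : Sup) (a : A) (b : B) : A ⊗ B :=
  closure (fun x y => x = a /\ y = b).

Section TensorUP.
Context {A B C : Sup}.

Lemma closed_down (D : A -> B -> Prop) a a' b b' : closed D ->
  a' ⊑ a -> b' ⊑ b -> D a b -> D a' b'.
Proof.
intros HD Ha Hb H.
assert (Ea : a = join (fun x => x ⊑ a)).
{ apply le_antisym; [apply join_ub, le_refl | now apply join_least]. }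
assert (Eb : b = join (fun y => y ⊑ b)).
{ apply le_antisym; [apply join_ub, le_refl | now apply join_least]. }
rewrite Ea in H.
pose proof (proj1 (proj1 HD _ _) H a' Ha) as H'.
rewrite Eb in H'; exact (proj1 (proj2 HD _ _) H' b' Hb).
Qed.

Lemma pure_leE (a : A) (b : B) (D : A ⊗ B) : pure a b ⊑ D <-> tset D a b.
Proof.
split.
- intros H; apply H, closure_in; now split.
- intros H; refine (closure_min (tens_closed D) _); now intros x y [-> ->].
Qed.

Lemma pure_bilinear : bilinear (@pure A B).
Proof.
apply mk_bilinear.
- intros S b D; rewrite pure_leE, (proj1 (tens_closed D)).
  now split; intros H a Ha; apply pure_leE; apply H.
- intros a T D; rewrite pure_leE, (proj2 (tens_closed D)).
  now split; intros H b Hb; apply pure_leE; apply H.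
Qed.

Lemma closed_below (f : A -> B -> C) (z : C) : bilinear f ->
  closed (fun a b => f a b ⊑ z).
Proof.
intros [H1 H2]; split.
- intros S b; rewrite H1; apply join_image_leE.
- intros a T; rewrite H2; apply join_image_leE.
Qed.

Definition tens_eval (f : A -> B -> C) (D : A ⊗ B) : C :=
  join (fun c => exists a b, tset D a b /\ f a b = c).

Lemma tens_eval_leE (f : A -> B -> C) D z :
  tens_eval f D ⊑ z <-> (forall a b, tset D a b -> f a b ⊑ z).
Proof.
unfold tens_eval; rewrite join_leE; split.
- intros H a b Hab; apply H; now exists a, b.
- intros H c [a [b [Hab <-]]]; now apply H.
Qed.

Definition tens_lift (f : A -> B -> C) (Hf : bilinear f) : Hom (A ⊗ B) C.
Proof.
refine (@mk_hom (A ⊗ B) C (tens_eval f) _); intros F z.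
rewrite tens_eval_leE; split.
- intros H D HD; apply tens_eval_leE; intros a b Hab.
  apply H, closure_in; now exists D.
- intros H; apply closure_min; [now apply closed_below|].
  intros a b [D [HD Hab]]; exact (proj1 (tens_eval_leE f D z) (H D HD) a b Hab).
Defined.

Lemma tens_lift_leE (f : A -> B -> C) (Hf : bilinear f) D z :
  tens_lift Hf D ⊑ z <-> (forall a b, tset D a b -> f a b ⊑ z).
Proof. apply tens_eval_leE. Qed.

Lemma tens_lift_pure (f : A -> B -> C) (Hf : bilinear f) a b :
  tens_lift Hf (pure a b) = f a b.
Proof.
apply le_ext; intros z; rewrite tens_lift_leE; split.
- intros H; apply H, closure_in; now split.
- intros H; apply closure_min; [now apply closed_below | now intros x y [-> ->]].
Qed.

Lemma tens_join_pure (D : A ⊗ B) :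
  D = join (fun t => exists a b, tset D a b /\ pure a b = t).
Proof.
apply le_ext; intros E; rewrite join_leE; split.
- intros H t [a [b [Hab <-]]]; apply pure_leE, H, Hab.
- intros H a b Hab; apply pure_leE, H; now exists a, b.
Qed.

Lemma tens_ext (f g : Hom (A ⊗ B) C) :
  (forall a b, f (pure a b) = g (pure a b)) -> f = g.
Proof.
intros H; apply hom_ext; intros D; rewrite (tens_join_pure D), !hom_join.
apply le_ext; intros z; rewrite !join_image_leE.
now split; intros K t [a [b [Hab <-]]]; [rewrite <- H | rewrite H];
  apply K; exists a, b.
Qed.

Lemma hom_tens_leE (h : Hom (A ⊗ B) C) D z :
  h D ⊑ z <-> (forall a b, tset D a b -> h (pure a b) ⊑ z).
Proof.
rewrite (tens_join_pure D) at 1; rewrite hom_leE; split.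
- intros H a b Hab; apply H; now exists a, b.
- intros H t [a [b [Hab <-]]]; now apply H.
Qed.

End TensorUP.

Lemma bilinear_leE1 (A B C : Sup) (f : A -> B -> C) (Hf : bilinear f) S b z :
  f (join S) b ⊑ z <-> (forall a, S a -> f a b ⊑ z).
Proof. rewrite (proj1 Hf); apply join_image_leE. Qed.

Lemma bilinear_leE2 (A B C : Sup) (f : A -> B -> C) (Hf : bilinear f) a T z :
  f a (join T) ⊑ z <-> (forall b, T b -> f a b ⊑ z).
Proof. rewrite (proj2 Hf); apply join_image_leE. Qed.

Lemma bilinear_comp (A B A' B' C C' : Sup) (h : Hom C C') (f : A -> B -> C)
    (p : Hom A' A) (q : Hom B' B) :
  bilinear f -> bilinear (fun a b => h (f (p a) (q b))).
Proof.
intros Hf; apply mk_bilinear.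
- intros S b z; rewrite hom_join, (proj1 Hf), hom_leE; split.
  + intros H a Ha; apply H; exists (p a); split; [now exists a | reflexivity].
  + intros H c [a [[a' [Ha' <-]] <-]]; now apply H.
- intros a T z; rewrite hom_join, (proj2 Hf), hom_leE; split.
  + intros H b Hb; apply H; exists (q b); split; [now exists b | reflexivity].
  + intros H c [b [[b' [Hb' <-]] <-]]; now apply H.
Qed.

Definition tens_map (A A' B B' : Sup) (f : Hom A A') (g : Hom B B') :
    Hom (A ⊗ B) (A' ⊗ B') :=
  tens_lift (bilinear_comp (hom_id (A' ⊗ B')) f g pure_bilinear).

Lemma tens_map_pure (A A' B B' : Sup) (f : Hom A A') (g : Hom B B') a b :
  tens_map f g (pure a b) = pure (f a) (g b).
Proof. unfold tens_map; now rewrite tens_lift_pure. Qed.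

Definition braid (A B : Sup) : Hom (A ⊗ B) (B ⊗ A).
Proof.
refine (@tens_lift A B (B ⊗ A) (fun a b => pure b a) _).
now apply mk_bilinear; intros; [apply (bilinear_leE2 pure_bilinear)
  | apply (bilinear_leE1 pure_bilinear)].
Defined.

Section Assoc.
Variables A B C : Sup.

Let r3 (a : A) (b : B) (c : C) : A ⊗ (B ⊗ C) := pure a (pure b c).
Let l3 (a : A) (b : B) (c : C) : (A ⊗ B) ⊗ C := pure (pure a b) c.

Lemma pure3r_leE1 S b c z : r3 (join S) b c ⊑ z <-> (forall a, S a -> r3 a b c ⊑ z).
Proof. apply (bilinear_leE1 pure_bilinear). Qed.
Lemma pure3r_leE2 a S c z : r3 a (join S) c ⊑ z <-> (forall b, S b -> r3 a b c ⊑ z).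
Proof.
unfold r3; rewrite (proj1 pure_bilinear), (bilinear_leE2 pure_bilinear).
split; [intros H b Hb; apply H; now exists b | now intros H t [b [Hb <-]]; apply H].
Qed.
Lemma pure3r_leE3 a b S z : r3 a b (join S) ⊑ z <-> (forall c, S c -> r3 a b c ⊑ z).
Proof.
unfold r3; rewrite (proj2 pure_bilinear), (bilinear_leE2 pure_bilinear).
split; [intros H c Hc; apply H; now exists c | now intros H t [c [Hc <-]]; apply H].
Qed.
Lemma pure3l_leE1 S b c z : l3 (join S) b c ⊑ z <-> (forall a, S a -> l3 a b c ⊑ z).
Proof.
unfold l3; rewrite (proj1 pure_bilinear), (bilinear_leE1 pure_bilinear).
split; [intros H a Ha; apply H; now exists a | now intros H t [a [Ha <-]]; apply H].
Qed.
Lemma pure3l_leE2 a S c z : l3 a (join S) c ⊑ z <-> (forall b, S b -> l3 a b c ⊑ z).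
Proof.
unfold l3; rewrite (proj2 pure_bilinear), (bilinear_leE1 pure_bilinear).
split; [intros H b Hb; apply H; now exists b | now intros H t [b [Hb <-]]; apply H].
Qed.
Lemma pure3l_leE3 a b S z : l3 a b (join S) ⊑ z <-> (forall c, S c -> l3 a b c ⊑ z).
Proof. apply (bilinear_leE2 pure_bilinear). Qed.

Lemma bilinear_r3 (c : C) : bilinear (fun a b => r3 a b c).
Proof. apply mk_bilinear; intros; [apply pure3r_leE1 | apply pure3r_leE2]. Qed.

Lemma bilinear_l3 (a : A) : bilinear (fun b c => l3 a b c).
Proof. apply mk_bilinear; intros; [apply pure3l_leE2 | apply pure3l_leE3]. Qed.

Lemma assoc_bilinear : bilinear (fun t c => tens_lift (bilinear_r3 c) t).
Proof.
apply mk_bilinear.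
- intros; apply hom_leE.
- intros t S z; rewrite tens_lift_leE; split.
  + intros H c Hc; apply tens_lift_leE; intros a b Hab.
    exact (proj1 (pure3r_leE3 _ _ _ _) (H a b Hab) c Hc).
  + intros H a b Hab; apply pure3r_leE3; intros c Hc.
    exact (proj1 (tens_lift_leE _ _ _) (H c Hc) a b Hab).
Qed.

Lemma assoc_inv_bilinear : bilinear (fun a t => tens_lift (bilinear_l3 a) t).
Proof.
apply mk_bilinear.
- intros S t z; rewrite tens_lift_leE; split.
  + intros H a Ha; apply tens_lift_leE; intros b c Hbc.
    exact (proj1 (pure3l_leE1 _ _ _ _) (H b c Hbc) a Ha).
  + intros H b c Hbc; apply pure3l_leE1; intros a Ha.
    exact (proj1 (tens_lift_leE _ _ _) (H a Ha) b c Hbc).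
- intros; apply hom_leE.
Qed.

Definition assoc : Hom ((A ⊗ B) ⊗ C) (A ⊗ (B ⊗ C)) := tens_lift assoc_bilinear.
Definition assoc_inv : Hom (A ⊗ (B ⊗ C)) ((A ⊗ B) ⊗ C) := tens_lift assoc_inv_bilinear.

Lemma assoc_pure a b c : assoc (pure (pure a b) c) = pure a (pure b c).
Proof. unfold assoc; rewrite tens_lift_pure; exact (tens_lift_pure (bilinear_r3 c) a b). Qed.

Lemma assoc_inv_pure a b c : assoc_inv (pure a (pure b c)) = pure (pure a b) c.
Proof. unfold assoc_inv; rewrite tens_lift_pure; exact (tens_lift_pure (bilinear_l3 a) b c). Qed.

End Assoc.

Definition Omega : Sup.
Proof.
refine (@MkSup Prop (fun p q => p -> q) _ _ _ (fun S => exists p, S p /\ p) _ _).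
- auto.
- auto.
- intros p q H1 H2; apply propositional_extensionality; now split.
- intros S p Hp p'; now exists p.
- intros S q H [p [Hp p']]; exact (H p Hp p').
Defined.

Section Unit.
Variable A : Sup.

(* The action of truth values: the join of the subsingleton [{a | p}]. *)
Definition guard (p : Omega) (a : A) : A := join (fun x => p /\ x = a).

Lemma guard_leE p a z : guard p a ⊑ z <-> (p -> a ⊑ z).
Proof.
unfold guard; rewrite join_leE; split.
- intros H Hp; now apply H.
- now intros H x [Hp ->]; apply H.
Qed.

Lemma guard_bilinear : bilinear guard.
Proof.
apply mk_bilinear.
- intros S b z; rewrite guard_leE; split.
  + intros H p Hp; apply guard_leE; intros p'; apply H; now exists p.
  + intros H [p [Hp p']]; exact (proj1 (guard_leE _ _ _) (H p Hp) p').
- intros p T z; rewrite guard_leE; split.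
  + intros H b Hb; apply guard_leE; intros Hp.
    exact (proj1 (join_leE T z) (H Hp) b Hb).
  + intros H Hp; apply join_leE; intros b Hb; exact (proj1 (guard_leE _ _ _) (H b Hb) Hp).
Qed.

Definition lunit : Hom (Omega ⊗ A) A := tens_lift guard_bilinear.
Definition lunit_inv : Hom A (Omega ⊗ A) :=
  @mk_hom A (Omega ⊗ A) (fun a => @pure Omega A True a)
    (fun S z => bilinear_leE2 pure_bilinear (True : Omega) S z).

Definition runit : Hom (A ⊗ Omega) A := lunit ∘ @braid A Omega.
Definition runit_inv : Hom A (A ⊗ Omega) := @braid Omega A ∘ lunit_inv.

Lemma lunit_pure (p : Omega) a : lunit (pure p a) = guard p a.
Proof. apply tens_lift_pure. Qed.

Lemma guard_hom (B : Sup) (h : Hom A B) (p : Omega) a z :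
  h (guard p a) ⊑ z <-> (p -> h a ⊑ z).
Proof.
unfold guard; rewrite hom_leE; split.
- intros H Hp; now apply H.
- now intros H x [Hp ->]; apply H.
Qed.

Lemma lunit_inv_r : lunit ∘ lunit_inv = hom_id A.
Proof.
apply hom_ext; intros a; refine (eq_trans (lunit_pure (True : Omega) a) _).
apply le_ext; intros z; rewrite guard_leE; simpl; tauto.
Qed.

Lemma lunit_inv_l : lunit_inv ∘ lunit = hom_id (Omega ⊗ A).
Proof.
apply tens_ext; intros p a.
change (lunit_inv (lunit (pure p a)) = pure p a); rewrite lunit_pure.
apply le_antisym.
- apply guard_hom; intros Hp; apply pure_leE; apply (closed_down (tens_closed _)
    (a := p) (b := a)); [intros _; exact Hp | apply le_refl |].
  apply closure_in; now split.
- assert (E : p = join (fun q : Omega => p /\ q = True)).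
  { apply propositional_extensionality; split.
    - intros Hp; exists True; repeat split; exact Hp.
    - now intros [q [[Hp _] _]]. }
  rewrite E at 1; apply (bilinear_leE1 pure_bilinear).
  intros q [Hp ->]; exact (proj1 (guard_hom lunit_inv p a _) (le_refl _) Hp).
Qed.

End Unit.

(* Duals are only determined up to isomorphism; since the monoidal structure is
   symmetric, left and right duals agree and [is_dual] is a symmetric notion. *)
Definition is_dual (L D : Sup) : Prop :=
  exists (coev : Hom Omega (L ⊗ D)) (ev : Hom (D ⊗ L) Omega),
    runit L ∘ tens_map (hom_id L) ev ∘ assoc L D L
      ∘ tens_map coev (hom_id L) ∘ lunit_inv L = hom_id L /\
    lunit D ∘ tens_map ev (hom_id D) ∘ assoc_inv D L D
      ∘ tens_map (hom_id D) coev ∘ runit_inv D = hom_id D.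

Definition dualisable (L : Sup) : Prop := exists D : Sup, is_dual L D.

Record Frame : Type := MkFrame {
  fsup :> Sup;
  meet : fsup -> fsup -> fsup;
  meet_lb1 : forall x y, meet x y ⊑ x;
  meet_lb2 : forall x y, meet x y ⊑ y;
  meet_glb : forall x y z, z ⊑ x -> z ⊑ y -> z ⊑ meet x y;
  meet_join : forall x S, meet x (join S) = join (image (meet x) S)
}.

Notation "x ⊓ y" := (meet x y) (at level 40, left associativity) : sup_scope.

Record FrameHom (A B : Frame) : Type := MkFrameHom {
  fhom :> Hom A B;
  fhom_top : fhom (top A) = top B;
  fhom_meet : forall x y, fhom (x ⊓ y) = fhom x ⊓ fhom y
}.

Section FrameLemmas.
Context {A : Frame}.

Lemma meet_leE (x y z : A) : z ⊑ x ⊓ y <-> z ⊑ x /\ z ⊑ y.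
Proof.
split.
- intros H; split; eapply le_trans; try exact H; [apply meet_lb1 | apply meet_lb2].
- intros [H1 H2]; now apply meet_glb.
Qed.

Lemma meet_comm (x y : A) : x ⊓ y = y ⊓ x.
Proof. apply le_antisym; apply meet_glb; try apply meet_lb1; apply meet_lb2. Qed.

Lemma meet_mono (x x' y y' : A) : x ⊑ x' -> y ⊑ y' -> x ⊓ y ⊑ x' ⊓ y'.
Proof.
intros Hx Hy; apply meet_glb; eapply le_trans;
  [apply meet_lb1 | exact Hx | apply meet_lb2 | exact Hy].
Qed.

Lemma meet_top (x : A) : x ⊓ top A = x.
Proof.
apply le_antisym; [apply meet_lb1|]; apply meet_glb; [apply le_refl | apply le_top].
Qed.

Lemma meet_join_l (S : A -> Prop) (x : A) : join S ⊓ x = join (image (fun s => s ⊓ x) S).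
Proof.
rewrite meet_comm, meet_join; apply le_ext; intros z; rewrite !join_image_leE.
now split; intros H s Hs; rewrite meet_comm; apply H.
Qed.

Lemma meet_bilinear : bilinear (@meet A).
Proof. split; [intros; apply meet_join_l | intros; apply meet_join]. Qed.

End FrameLemmas.

Definition OmegaF : Frame.
Proof.
refine (@MkFrame Omega and _ _ _ _); simpl.
- tauto.
- tauto.
- tauto.
- intros p S; apply (@le_antisym Omega).
  + intros [Hp [q [Hq q']]]; exists (p /\ q); split; [now exists q | now split].
  + intros [r [[q [Hq <-]] [Hp q']]]; split; [exact Hp | now exists q].
Defined.

(* The coproduct of frames is constructed on the tensor product of suplattices;
   its universal property is [copair], [copair_inj1], [copair_inj2] and
   [copair_unique]. *)

Section Coproduct.
Variables A B : Frame.

Lemma closed_shift (D : A ⊗ B) (x : A) (y : B) :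
  closed (fun a b => tset D (a ⊓ x) (b ⊓ y)).
Proof.
split.
- intros S b; rewrite meet_join_l, (proj1 (tens_closed D)); split.
  + intros H a Ha; apply H; now exists a.
  + now intros H t [a [Ha <-]]; apply H.
- intros a T; rewrite meet_join_l, (proj2 (tens_closed D)); split.
  + intros H b Hb; apply H; now exists b.
  + now intros H t [b [Hb <-]]; apply H.
Qed.

Definition tens_meet (D E : A ⊗ B) : A ⊗ B.
Proof.
refine (@MkTens A B (fun a b => tset D a b /\ tset E a b) _).
split.
- intros S b; rewrite (proj1 (tens_closed D)), (proj1 (tens_closed E)); firstorder.
- intros a T; rewrite (proj2 (tens_closed D)), (proj2 (tens_closed E)); firstorder.
Defined.

Lemma tens_meet_join (D : A ⊗ B) (F : A ⊗ B -> Prop) :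
  tens_meet D (join F) = join (image (tens_meet D) F).
Proof.
apply (@le_antisym (A ⊗ B)).
- intros a b [HD HF].
  pose (J := join (image (tens_meet D) F)).
  assert (K : tset J (a ⊓ a) (b ⊓ b)).
  { apply (@closure_min A B (fun a b => exists E : Tens A B, F E /\ E a b)
      (fun x y => tset J (x ⊓ a) (y ⊓ b)) (closed_shift J a b)); [|exact HF].
    intros x y [E [HE Hxy]]; apply closure_in; exists (tens_meet D E).
    split; [now exists E|]; split.
    - apply (closed_down (tens_closed D) (a := a) (b := b)); auto using meet_lb2.
    - apply (closed_down (tens_closed E) (a := x) (b := y)); auto using meet_lb1. }
  revert K; apply (closed_down (tens_closed J)); apply meet_glb; apply le_refl.
- apply join_image_leE; intros E HE a b [H1 H2]; split; [exact H1|].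
  apply closure_in; now exists E.
Qed.

Definition coprod : Frame :=
  @MkFrame (A ⊗ B) tens_meet
    (fun D E a b H => proj1 H) (fun D E a b H => proj2 H)
    (fun D E K H1 H2 a b H => conj (H1 a b H) (H2 a b H))
    tens_meet_join.

Lemma meet_pure (a a' : A) (b b' : B) :
  @meet coprod (pure a b) (pure a' b') = pure (a ⊓ a') (b ⊓ b').
Proof.
apply (@le_antisym (A ⊗ B)).
- intros x y [H1 H2].
  pose (J := pure (a ⊓ a') (b ⊓ b')).
  assert (K1 : tset J (a ⊓ x) (b ⊓ y)).
  { assert (K0 : tset J (x ⊓ a) (y ⊓ b)).
    { apply (closure_min (closed_shift J a b)) in H2; [exact H2|].
      intros u v [-> ->]; rewrite (meet_comm a'), (meet_comm b').
      apply closure_in; now split. }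
    now rewrite (meet_comm a), (meet_comm b). }
  apply (closed_down (tens_closed J) (a := x ⊓ x) (b := y ⊓ y));
    [apply meet_glb; apply le_refl | apply meet_glb; apply le_refl |].
  apply (closure_min (closed_shift J x y)) in H1; [exact H1|].
  now intros u v [-> ->].
- apply pure_leE; split.
  + apply (closed_down (tens_closed _) (meet_lb1 _ _) (meet_lb1 _ _)).
    apply closure_in; now split.
  + apply (closed_down (tens_closed _) (meet_lb2 _ _) (meet_lb2 _ _)).
    apply closure_in; now split.
Qed.

Lemma pure_top : @pure A B (top A) (top B) = top (A ⊗ B).
Proof.
apply le_antisym; [apply le_top|]; intros a b _.
apply (closed_down (tens_closed _) (le_top a) (le_top b)), closure_in; now split.
Qed.

Definition inj1 : FrameHom A coprod.
Proof.
refine (@MkFrameHom A coprod (@mk_hom A coprod (fun a => pure a (top B))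
  (fun S z => bilinear_leE1 pure_bilinear S (top B) z)) _ _).
- exact pure_top.
- intros x y; refine (eq_sym (eq_trans (meet_pure _ _ _ _) _)); simpl.
  now rewrite meet_top.
Defined.

Definition inj2 : FrameHom B coprod.
Proof.
refine (@MkFrameHom B coprod (@mk_hom B coprod (fun b => pure (top A) b)
  (fun S z => bilinear_leE2 pure_bilinear (top A) S z)) _ _).
- exact pure_top.
- intros x y; refine (eq_sym (eq_trans (meet_pure _ _ _ _) _)); simpl.
  now rewrite meet_top.
Defined.

End Coproduct.

Notation "A ⊕ B" := (coprod A B) (at level 35, right associativity) : sup_scope.

Section Copair.
Context {A B C : Frame}.

Lemma copair_bilinear (f : FrameHom A C) (g : FrameHom B C) :
  bilinear (fun a b => f a ⊓ g b).
Proof. exact (bilinear_comp (hom_id C) f g meet_bilinear). Qed.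

Definition copair (f : FrameHom A C) (g : FrameHom B C) : FrameHom (A ⊕ B) C.
Proof.
refine (@MkFrameHom (A ⊕ B) C (tens_lift (copair_bilinear f g)) _ _).
- change (top (A ⊕ B)) with (top (A ⊗ B)); rewrite <- (pure_top A B).
  refine (eq_trans (tens_lift_pure (copair_bilinear f g) _ _) _).
  now rewrite !fhom_top, meet_top.
- intros D E; apply le_antisym.
  + apply meet_glb; apply hom_mono; [apply meet_lb1 | apply meet_lb2].
  + refine (proj2 (bilinear_leE1 meet_bilinear _ _ _) _).
    intros c [a [b [HD <-]]].
    refine (proj2 (bilinear_leE2 meet_bilinear _ _ _) _).
    intros c' [a' [b' [HE <-]]].
    apply le_trans with (f (a ⊓ a') ⊓ g (b ⊓ b')).
    * rewrite !fhom_meet; rewrite !meet_leE; repeat split;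
        eauto using le_trans, meet_lb1, meet_lb2.
    * apply join_ub; exists (a ⊓ a'), (b ⊓ b'); split; [split|reflexivity].
      -- exact (closed_down (tens_closed D) (meet_lb1 _ _) (meet_lb1 _ _) HD).
      -- exact (closed_down (tens_closed E) (meet_lb2 _ _) (meet_lb2 _ _) HE).
Defined.

Lemma copair_pure f g a b : copair f g (pure a b) = f a ⊓ g b.
Proof. exact (tens_lift_pure (copair_bilinear f g) a b). Qed.

Lemma copair_inj1 f g a : copair f g (inj1 A B a) = f a.
Proof. refine (eq_trans (copair_pure f g a (top B)) _); now rewrite fhom_top, meet_top. Qed.

Lemma copair_inj2 f g b : copair f g (inj2 A B b) = g b.
Proof. refine (eq_trans (copair_pure f g (top A) b) _).
now rewrite fhom_top, meet_comm, meet_top. Qed.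

Lemma copair_unique (f : FrameHom A C) (g : FrameHom B C) (h : FrameHom (A ⊕ B) C) :
  (forall a, h (inj1 A B a) = f a) -> (forall b, h (inj2 A B b) = g b) ->
  forall D, h D = copair f g D.
Proof.
intros H1 H2 D; enough (E : fhom h = copair f g) by now rewrite E.
apply tens_ext; intros a b; rewrite copair_pure, <- H1, <- H2, <- fhom_meet.
apply f_equal; symmetry; refine (eq_trans (meet_pure a (top A) (top B) b) _).
now rewrite meet_top, meet_comm, meet_top.
Qed.

End Copair.

Definition positive (A : Sup) (a : A) : Prop :=
  forall I : A -> Prop, a ⊑ join I -> exists x, I x.

Definition overt (X : Frame) : Prop :=
  exists base : X -> Prop,
    (forall b, base b -> positive b) /\
    (forall a, exists S : X -> Prop, (forall b, S b -> base b) /\ a = join S).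

(* A commutative monoid object in locales, given by its frame of opens: the
   monoid laws are read contravariantly, and the structure isomorphisms of the
   coproduct of frames are those of the underlying tensor product. *)
Record CommLocMonoid : Type := MkCommLocMonoid {
  opens : Frame;
  eps1 : FrameHom opens OmegaF;
  mu : FrameHom opens (opens ⊕ opens);
  mu_unit_l : lunit opens ∘ tens_map eps1 (hom_id opens) ∘ mu = hom_id opens;
  mu_unit_r : runit opens ∘ tens_map (hom_id opens) eps1 ∘ mu = hom_id opens;
  mu_assoc : assoc opens opens opens ∘ tens_map mu (hom_id opens) ∘ mu
             = tens_map (hom_id opens) mu ∘ mu;
  mu_comm : @braid opens opens ∘ mu = mu
}.

Section Monoid.
Variable M : CommLocMonoid.
Let OM : Frame := opens M.
Let m : FrameHom OM (OM ⊕ OM) := mu M.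

Definition saturated (s : OM) : Prop := m s ⊑ inj1 OM OM s.

Lemma saturated_join (S : OM -> Prop) :
  (forall s, S s -> saturated s) -> saturated (join S).
Proof.
intros H; apply hom_leE; intros s Hs.
apply le_trans with (inj1 OM OM s); [now apply H | apply hom_mono, join_ub, Hs].
Qed.

Lemma saturated_meet s t : saturated s -> saturated t -> saturated (s ⊓ t).
Proof. unfold saturated; intros Hs Ht; rewrite !fhom_meet; now apply meet_mono. Qed.

Record Sat : Type := MkSat { sval :> OM; sat_prop : saturated sval }.

Lemma sat_ext (s t : Sat) : sval s = sval t -> s = t.
Proof.
destruct s as [s Hs], t as [t Ht]; simpl; intros E; destruct E.
f_equal; apply proof_irrelevance.
Qed.

Lemma saturated_join_image (S : Sat -> Prop) : saturated (join (image sval S)).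
Proof. apply saturated_join; intros s [t [_ <-]]; apply sat_prop. Qed.

Definition sat_join (S : Sat -> Prop) : Sat := MkSat (@saturated_join_image S).

Definition sat_sup : Sup.
Proof.
refine (@MkSup Sat (fun s t => sval s ⊑ sval t) _ _ _ sat_join _ _).
- intros; apply le_refl.
- intros x y z; apply le_trans.
- intros x y H1 H2; apply sat_ext; now apply le_antisym.
- intros S x Hx; exact (join_image_mono sval Hx).
- intros S z H; apply join_image_leE; exact H.
Defined.

Definition sat_meet (s t : Sat) : Sat :=
  MkSat (@saturated_meet s t (@sat_prop s) (@sat_prop t)).

Definition sat_frame : Frame.
Proof.
refine (@MkFrame sat_sup sat_meet _ _ _ _); simpl.
- intros; apply meet_lb1.
- intros; apply meet_lb2.
- intros x y z; apply meet_glb.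
- intros x S; apply sat_ext; simpl; rewrite meet_join.
  apply le_ext; intros z; rewrite !join_image_leE; split.
  + intros H t [s [Hs <-]]; simpl; apply H; now exists s.
  + intros H t [s [Hs <-]].
    apply (H (sat_meet x s)); now exists s.
Defined.

Lemma and_bilinear : @bilinear Omega Omega Omega and.
Proof. exact (@meet_bilinear OmegaF). Qed.

Definition Delta : Hom (Omega ⊗ Omega) Omega := tens_lift and_bilinear.

(* Elements of [hom_sup OM Omega] are the overt weakly closed sublocales. *)
Definition conv (f g : hom_sup OM Omega) : hom_sup OM Omega :=
  Delta ∘ tens_map f g ∘ m.

Definition monoid_ideal (I : hom_sup OM Omega) : Prop :=
  I = conv I (top (hom_sup OM Omega)).

Lemma convE (f g : hom_sup OM Omega) (u : OM) :
  conv f g u <-> exists a b, tset (m u) a b /\ f a /\ g b.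
Proof.
change (conv f g u) with ((Delta ∘ tens_map f g) (m u)); split.
- intros H; revert H.
  change ((Delta ∘ tens_map f g) (m u) ⊑
    (exists a b, tset (m u) a b /\ f a /\ g b : Omega)).
  apply hom_tens_leE; intros a b Hab.
  change ((Delta ∘ tens_map f g) (pure a b)) with (Delta (tens_map f g (pure a b))).
  rewrite tens_map_pure; unfold Delta; rewrite tens_lift_pure.
  intros [Hf Hg]; now exists a, b.
- intros [a [b [Hab [Hf Hg]]]].
  refine (proj1 (hom_tens_leE (Delta ∘ tens_map f g) (m u)
    ((Delta ∘ tens_map f g) (m u))) (@le_refl Omega _) a b Hab _).
  change ((Delta ∘ tens_map f g) (pure a b)) with (Delta (tens_map f g (pure a b))).
  rewrite tens_map_pure; unfold Delta; rewrite tens_lift_pure; now split.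
Qed.

Lemma monoid_ideal_join (F : hom_sup OM Omega -> Prop) :
  (forall I, F I -> monoid_ideal I) -> monoid_ideal (join F).
Proof.
intros H; apply hom_ext; intros u; apply propositional_extensionality.
rewrite convE; split.
- intros [p [[I [HI <-]] Hu]]; rewrite (H I HI) in Hu; apply convE in Hu.
  destruct Hu as [a [b [Hab [Ha Hb]]]]; exists a, b; split; [exact Hab|].
  split; [|exact Hb]; exists (I a); split; [now exists I | exact Ha].
- intros [a [b [Hab [[p [[I [HI <-]] Ha]] Hb]]]].
  exists (I u); split; [now exists I|]; rewrite (H I HI); apply convE.
  now exists a, b.
Qed.

Record Ideal : Type := MkIdeal {
  ival :> hom_sup OM Omega;
  ideal_prop : monoid_ideal ival
}.

Lemma ideal_ext (I J : Ideal) : ival I = ival J -> I = J.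
Proof.
destruct I as [I HI], J as [J HJ]; simpl; intros E; destruct E.
f_equal; apply proof_irrelevance.
Qed.

Lemma monoid_ideal_join_image (F : Ideal -> Prop) :
  monoid_ideal (join (image ival F)).
Proof. apply monoid_ideal_join; intros I [J [_ <-]]; apply ideal_prop. Qed.

Definition ideal_join (F : Ideal -> Prop) : Ideal :=
  MkIdeal (@monoid_ideal_join_image F).

Definition ideal_sup : Sup.
Proof.
refine (@MkSup Ideal (fun I J => ival I ⊑ ival J) _ _ _ ideal_join _ _).
- intros; apply le_refl.
- intros x y z; apply le_trans.
- intros x y H1 H2; apply ideal_ext; now apply le_antisym.
- intros F I HI; exact (join_image_mono ival HI).
- intros F J H; apply join_image_leE; exact H.
Defined.

End Monoid.

(* Main.v *)
(** A dual of [L], when it exists, is [hom L Omega], so it suffices to identify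
    the monoid ideals with the suplattice maps from the saturated opens to
    [Omega].  Since [M] is overt, the projection [M × M -> M] is open and every
    open [u] has a saturation [{x | exists y, x y \in u}]; this is a
    join-preserving retraction [OM -> SM] of the inclusion of the saturated
    opens.  As [W · top] is [W] precomposed with saturation, the monoid ideals
    are exactly the maps [OM -> Omega] that factor through this retraction. *)

Require Import Defs.

Set Implicit Arguments.
Unset Strict Implicit.
Unset Printing Implicit Defensive.

(** * Calculus of pure tensors and of the action of truth values *)

Lemma pure_mono (A B : Sup) (a a' : A) (b b' : B) :
  a ⊑ a' -> b ⊑ b' -> pure a b ⊑ pure a' b'.
Proof.
intros Ha Hb; apply pure_leE, (closed_down (tens_closed _) Ha Hb).
now apply pure_leE, le_refl.
Qed.

Lemma tens_le_forall (A B : Sup) (D E : A ⊗ B) :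
  D ⊑ E <-> (forall a b, tset D a b -> pure a b ⊑ E).
Proof. exact (hom_tens_leE (hom_id (A ⊗ B)) D E). Qed.

Lemma guard_true (A : Sup) (p : Omega) (a : A) : p -> guard p a = a.
Proof. intros Hp; apply le_ext; intros z; rewrite guard_leE; tauto. Qed.

Lemma hom_guard_prop (A : Sup) (f : Hom A Omega) (p : Omega) (a : A) :
  f (guard p a) = (p /\ f a).
Proof.
apply (@le_antisym Omega).
- apply (guard_hom f); intros Hp Hf; now split.
- intros [Hp Hf]; now rewrite guard_true.
Qed.

Lemma hom_pure_l_leE (A B C E : Sup) (h : Hom ((A ⊗ B) ⊗ C) E) D c z :
  h (pure D c) ⊑ z <-> (forall a b, tset D a b -> h (pure (pure a b) c) ⊑ z).
Proof.
exact (hom_tens_leE (h ∘ mk_hom (fun S => bilinear_leE1 pure_bilinear S c)) D z).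
Qed.

Lemma hom_pure_r_leE (A B C E : Sup) (h : Hom (C ⊗ (A ⊗ B)) E) D c z :
  h (pure c D) ⊑ z <-> (forall a b, tset D a b -> h (pure c (pure a b)) ⊑ z).
Proof.
exact (hom_tens_leE (h ∘ mk_hom (fun S => bilinear_leE2 pure_bilinear c S)) D z).
Qed.

Lemma runit_pure (A : Sup) (a : A) (p : Omega) : runit A (pure a p) = guard p a.
Proof.
change (lunit A (braid A Omega (pure a p)) = guard p a).
unfold braid; rewrite tens_lift_pure; apply lunit_pure.
Qed.

Lemma runit_inv_pure (A : Sup) (a : A) : runit_inv A a = pure a (True : Omega).
Proof. exact (tens_lift_pure _ (True : Omega) a). Qed.

(** * The triangle identities in terms of elements *)

Lemma snake1_leE (L D : Sup) (coev : Hom Omega (L ⊗ D)) (ev : Hom (D ⊗ L) Omega)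
    (l z : L) :
  (runit L ∘ tens_map (hom_id L) ev ∘ assoc L D L
     ∘ tens_map coev (hom_id L) ∘ lunit_inv L) l ⊑ z
  <-> (forall a d, tset (coev (True : Omega)) a d -> ev (pure d l) -> a ⊑ z).
Proof.
pose (h := runit L ∘ tens_map (hom_id L) ev ∘ assoc L D L).
change (h (tens_map coev (hom_id L) (pure (True : Omega) l)) ⊑ z <->
  (forall a d, tset (coev (True : Omega)) a d -> ev (pure d l) -> a ⊑ z)).
assert (E : forall a d, h (pure (pure a d) (hom_id L l)) = guard (ev (pure d l)) a).
{ intros a d.
  change (runit L (tens_map (hom_id L) ev (assoc L D L (pure (pure a d) l)))
    = guard (ev (pure d l)) a).
  now rewrite assoc_pure, tens_map_pure, runit_pure. }
rewrite tens_map_pure, hom_pure_l_leE.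
split; intros H a d Had; specialize (H a d Had).
- rewrite E in H; exact (proj1 (guard_leE _ _ _) H).
- rewrite E; exact (proj2 (guard_leE _ _ _) H).
Qed.

Lemma snake2_leE (L D : Sup) (coev : Hom Omega (L ⊗ D)) (ev : Hom (D ⊗ L) Omega)
    (d z : D) :
  (lunit D ∘ tens_map ev (hom_id D) ∘ assoc_inv D L D
     ∘ tens_map (hom_id D) coev ∘ runit_inv D) d ⊑ z
  <-> (forall a d', tset (coev (True : Omega)) a d' -> ev (pure d a) -> d' ⊑ z).
Proof.
pose (h := lunit D ∘ tens_map ev (hom_id D) ∘ assoc_inv D L D).
change (h (tens_map (hom_id D) coev (runit_inv D d)) ⊑ z <->
  (forall a d', tset (coev (True : Omega)) a d' -> ev (pure d a) -> d' ⊑ z)).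
assert (E : forall a d', h (pure (hom_id D d) (pure a d')) = guard (ev (pure d a)) d').
{ intros a d'.
  change (lunit D (tens_map ev (hom_id D) (assoc_inv D L D (pure d (pure a d'))))
    = guard (ev (pure d a)) d').
  now rewrite assoc_inv_pure, tens_map_pure, lunit_pure. }
rewrite runit_inv_pure, tens_map_pure, hom_pure_r_leE.
split; intros H a d' Had; specialize (H a d' Had).
- rewrite E in H; exact (proj1 (guard_leE _ _ _) H).
- rewrite E; exact (proj2 (guard_leE _ _ _) H).
Qed.

(** The pairs [(a, d)] in [coev True] act as a dual basis: each [l] is the join of the [a] with
    [ev (pure d l)], and dually for [d]. Phrasing this through upper bounds removes the structure
    isomorphisms from all later arguments. *)
Lemma is_dualE (L D : Sup) :
  is_dual L D <-> exists (coev : Hom Omega (L ⊗ D)) (ev : Hom (D ⊗ L) Omega),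
    (forall l z : L, (forall a d, tset (coev (True : Omega)) a d ->
       ev (pure d l) -> a ⊑ z) <-> l ⊑ z) /\
    (forall d z : D, (forall a d', tset (coev (True : Omega)) a d' ->
       ev (pure d a) -> d' ⊑ z) <-> d ⊑ z).
Proof.
split; intros [coev [ev [H1 H2]]]; exists coev, ev; split.
- intros l z; now rewrite <- snake1_leE, H1.
- intros d z; now rewrite <- snake2_leE, H2.
- apply hom_ext; intros l; apply le_ext; intros z; now rewrite snake1_leE, H1.
- apply hom_ext; intros d; apply le_ext; intros z; now rewrite snake2_leE, H2.
Qed.

(** * Transport of duals along isomorphisms *)

Lemma tset_tens_map (A A' B B' : Sup) (f : Hom A A') (g : Hom B B') (D : A ⊗ B) a b :
  tset D a b -> tset (tens_map f g D) (f a) (g b).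
Proof.
intros H; apply pure_leE; rewrite <- tens_map_pure.
now apply hom_mono, pure_leE.
Qed.

(** An induction principle for membership in [tens_map f g D]: a closed [P] is itself an element of
    the tensor product, so it is enough to bound the generating pure tensors by it. *)
Lemma tset_tens_map_min (A A' B B' : Sup) (f : Hom A A') (g : Hom B B') (D : A ⊗ B)
    (P : A' -> B' -> Prop) : closed P ->
  (forall a b, tset D a b -> P (f a) (g b)) ->
  forall a b, tset (tens_map f g D) a b -> P a b.
Proof.
intros HP H.
change (tens_map f g D ⊑ (MkTens HP : A' ⊗ B')).
apply hom_tens_leE; intros a b Hab; rewrite tens_map_pure.
now apply pure_leE, H.
Qed.

(** The predicate says [guard (h b) (k a) ⊑ z], a bound on an expression bilinear in [a] and [b]. It
    supplies closed sets for the induction principle above. *)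
Lemma closed_imp_le1 (A B C : Sup) (h : Hom B Omega) (k : Hom A C) (z : C) :
  closed (fun (a : A) (b : B) => h b -> k a ⊑ z).
Proof.
split.
- intros S b; split.
  + intros H a Ha Hh; exact (proj1 (hom_leE k S z) (H Hh) a Ha).
  + intros H Hh; apply hom_leE; intros a Ha; exact (H a Ha Hh).
- intros a T; rewrite hom_join; split.
  + intros H b Hb Hh; apply H; exists (h b); split; [now exists b | exact Hh].
  + intros H [p [[b [Hb <-]] Hh]]; exact (H b Hb Hh).
Qed.

Lemma closed_imp_le2 (A B C : Sup) (h : Hom A Omega) (k : Hom B C) (z : C) :
  closed (fun (a : A) (b : B) => h a -> k b ⊑ z).
Proof.
split.
- intros S b; rewrite hom_join; split.
  + intros H a Ha Hh; apply H; exists (h a); split; [now exists a | exact Hh].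
  + intros H [p [[a [Ha <-]] Hh]]; exact (H a Ha Hh).
- intros a T; split.
  + intros H b Hb Hh; exact (proj1 (hom_leE k T z) (H Hh) b Hb).
  + intros H Hh; apply hom_leE; intros b Hb; exact (H b Hb Hh).
Qed.

Definition curry_l (A B C : Sup) (h : Hom (A ⊗ B) C) (b : B) : Hom A C :=
  h ∘ mk_hom (fun S => bilinear_leE1 pure_bilinear S b).

Definition curry_r (A B C : Sup) (h : Hom (A ⊗ B) C) (a : A) : Hom B C :=
  h ∘ mk_hom (fun S => bilinear_leE2 pure_bilinear a S).

(** The new coevaluation is [(id ⊗ f) ∘ coev] and the new evaluation is [ev ∘ (g ⊗ id)]; the
    inserted [f] and [g] cancel in both triangles. *)
Lemma is_dual_transport (L D D' : Sup) (f : Hom D D') (g : Hom D' D) :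
  f ∘ g = hom_id D' -> g ∘ f = hom_id D -> is_dual L D -> is_dual L D'.
Proof.
intros Hfg Hgf [coev [ev [H1 H2]]]%is_dualE.
assert (Kfg : forall x, f (g x) = x) by
  (intros x; exact (f_equal (fun k : Hom D' D' => k x) Hfg)).
assert (Kgf : forall x, g (f x) = x) by
  (intros x; exact (f_equal (fun k : Hom D D => k x) Hgf)).
set (ev' := ev ∘ tens_map g (hom_id L)).
assert (E : forall d l, ev' (pure d l) = ev (pure (g d) l)).
{ intros d l; change (ev (tens_map g (hom_id L) (pure d l)) = ev (pure (g d) l)).
  now rewrite tens_map_pure. }
apply is_dualE; exists (tens_map (hom_id L) f ∘ coev), ev'; split.
- intros l z; rewrite <- H1; split.
  + intros H a d Had He; apply (H a (f d)); [|now rewrite E, Kgf].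
    exact (tset_tens_map (f := hom_id L) (g := f) Had).
  + intros H; refine (tset_tens_map_min (f := hom_id L) (g := f)
      (P := fun a d => ev' (pure d l) -> a ⊑ z) _ _).
    * exact (closed_imp_le1 (curry_l ev' l) (hom_id L) z).
    * intros a d Had; rewrite E, Kgf; exact (H a d Had).
- intros d z; split.
  + intros H; rewrite <- (Kfg d), <- (Kfg z); apply hom_mono, H2.
    intros a d' Had He; rewrite <- (Kgf d'); apply hom_mono.
    apply (H a (f d')); [|now rewrite E].
    exact (tset_tens_map (f := hom_id L) (g := f) Had).
  + intros H; refine (tset_tens_map_min (f := hom_id L) (g := f)
      (P := fun a d' => ev' (pure d a) -> d' ⊑ z) _ _).
    * exact (closed_imp_le2 (curry_r ev' d) (hom_id D') z).
    * intros a d' Had; rewrite E; intros He.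
      rewrite <- (Kfg z); apply hom_mono.
      exact (proj2 (H2 (g d) (g z)) (hom_mono g H) a d' Had He).
Qed.

(** * The canonical dual [hom_sup L Omega] *)

Definition ev_curry (L D : Sup) (ev : Hom (D ⊗ L) Omega) : Hom D (hom_sup L Omega).
Proof.
refine (@mk_hom D (hom_sup L Omega) (curry_r ev) _); intros S z; split.
- intros H d Hd l.
  exact (proj1 (hom_leE (curry_l ev l) S (z l)) (H l) d Hd).
- intros H l; apply (hom_leE (curry_l ev l)); intros d Hd; exact (H d Hd l).
Defined.

(** Contraction of [T] against [f] in its first factor, that is [f ⊗ id] followed by the left unit
    isomorphism. *)
Definition coev_eval (L D : Sup) (T : L ⊗ D) : Hom (hom_sup L Omega) D.
Proof.
refine (@mk_hom (hom_sup L Omega) D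
  (fun f => join (fun d => exists a, tset T a d /\ hfun f a)) _).
intros S z; rewrite join_leE; split.
- intros H f Hf; apply join_leE; intros d [a [Had Ha]]; apply H.
  exists a; split; [exact Had|]; exists (f a); split; [now exists f | exact Ha].
- intros H d [a [Had [p [[f [Hf <-]] Ha]]]].
  apply (proj1 (join_leE _ _) (H f Hf)); now exists a.
Defined.

(** Currying [ev] and contracting [coev True] are mutually inverse, one composite by each triangle
    identity, so the given dual can be replaced by the hom. *)
Lemma dualisable_hom (L : Sup) : dualisable L -> is_dual L (hom_sup L Omega).
Proof.
intros [D HD]; pose proof HD as [coev [ev [H1 H2]]]%is_dualE.
refine (is_dual_transport (f := ev_curry ev) (g := coev_eval (coev (True : Omega)))
  _ _ HD).
- apply hom_ext; intros f; apply hom_ext; intros l.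
  apply le_ext; intros z.
  change (curry_l ev l (coev_eval (coev (True : Omega)) f) ⊑ z <-> f l ⊑ z).
  refine (iff_trans (hom_leE (curry_l ev l) _ _) _).
  (* This join is the right adjoint of [f] at [z]. It turns [f l ⊑ z] into a bound on [l], to which
     the expansion [H1] applies. *)
  transitivity (l ⊑ join (fun a => f a ⊑ z)).
  + rewrite <- H1; split.
    * intros H a d Had He; apply join_ub; intros Ha.
      apply (H d); [now exists a | exact He].
    * intros H d [a [Had Ha]] He.
      specialize (H a d Had He); apply (hom_mono f) in H; specialize (H Ha).
      rewrite hom_join in H; destruct H as [p [[b [Hb <-]] Hp]]; exact (Hb Hp).
  + split.
    * intros H; apply (le_trans (hom_mono f H)), hom_leE; auto.
    * intros H; apply join_ub, H.
- apply hom_ext; intros d; apply le_ext; intros z.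
  refine (iff_trans (join_leE _ _) _).
  transitivity (d ⊑ z); [|reflexivity]; rewrite <- H2; split.
  + intros H a d' Had He; apply H; now exists a.
  + intros H d' [a [Had He]]; exact (H a d' Had He).
Qed.

(** * Positivity and saturation in an overt monoid *)

Lemma positive_up (A : Sup) (a b : A) : a ⊑ b -> positive a -> positive b.
Proof. intros Hab Ha I HI; exact (Ha I (le_trans Hab HI)). Qed.

Section Saturation.

Variable M : CommLocMonoid.
Let OM : Frame := opens M.

Context (hovert : overt OM).

Lemma positive_join (S : OM -> Prop) :
  positive (join S) <-> exists s, S s /\ positive s.
Proof.
destruct hovert as [base [Hb Hbase]]; split.
- intros H.
  (* The basic elements lying below some member of [S] cover [join S]; positivity yields one of
     them, and basic elements are positive. *)
  destruct (H (fun b => base b /\ exists s, S s /\ b ⊑ s)) as [b [Bb [s [Hs Hbs]]]].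
  + apply join_least; intros s Hs; destruct (Hbase s) as [S' [HS' E]].
    rewrite E at 1; apply join_least; intros b Hb'; apply join_ub.
    split; [now apply HS'|]; exists s; split; [exact Hs|].
    rewrite E; now apply join_ub.
  + exists s; split; [exact Hs | exact (positive_up Hbs (Hb b Bb))].
- intros [s [Hs Hp]]; exact (positive_up (join_ub Hs) Hp).
Qed.

Definition pos_hom : Hom OM Omega.
Proof.
refine (@mk_hom OM Omega (@positive OM) _); intros S z; split.
- intros H s Hs Ps; apply H, positive_join; now exists s.
- intros H [s [Hs Ps]]%positive_join; exact (H s Hs Ps).
Defined.

Let T : Hom OM Omega := top (hom_sup OM Omega).

(** Every basic part of [u] is positive, hence witnesses [T u], because [T] dominates [pos_hom]. *)
Lemma le_guard_top (u : OM) : u ⊑ guard (T u) (top OM).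
Proof.
pose proof hovert as [base [Hb Hbase]].
destruct (Hbase u) as [S [HS E]]; rewrite E at 1.
apply join_least; intros b Sb; rewrite guard_true; [apply le_top|].
assert (Hbu : b ⊑ u) by (rewrite E; now apply join_ub).
apply (@le_top (hom_sup OM Omega) pos_hom u).
exact (positive_up Hbu (Hb b (HS b Sb))).
Qed.

(** The saturation: preimage along multiplication, then [id ⊗ T], the direct image along the first
    projection. *)
Definition sat_hom : Hom OM OM := runit OM ∘ tens_map (hom_id OM) T ∘ mu M.

Lemma sat_hom_leE u z :
  sat_hom u ⊑ z <-> (forall a b, tset (mu M u) a b -> T b -> a ⊑ z).
Proof.
change (sat_hom u) with ((runit OM ∘ tens_map (hom_id OM) T) (mu M u)).
rewrite (hom_tens_leE (runit OM ∘ tens_map (hom_id OM) T)).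
assert (E : forall a b, (runit OM ∘ tens_map (hom_id OM) T) (pure a b) = guard (T b) a).
{ intros a b; change (runit OM (tens_map (hom_id OM) T (pure a b)) = guard (T b) a).
  now rewrite tens_map_pure, runit_pure. }
split; intros H a b Hab; specialize (H a b Hab); rewrite E in *;
  now apply guard_leE.
Qed.

(** As the top map, [T] dominates [conv T T], so a pair in [mu u] with [T] true on both coordinates
    forces [T u]. Truth of [T a] may be assumed by [le_guard_top]. *)
Lemma sat_hom_le_guard u : sat_hom u ⊑ guard (T u) (top OM).
Proof.
apply sat_hom_leE; intros a b Hab Tb.
apply (le_trans (le_guard_top a)), guard_leE; intros Ta.
rewrite guard_true; [apply le_refl|].
apply (@le_top (hom_sup OM Omega) (conv T T) u), convE; now exists a, b.
Qed.

(** Coassociativity rewrites [mu (sat_hom u)] as [(id ⊗ sat_hom) (mu u)]. There [sat_hom q] is at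
    most [guard (T q) (top OM)], and [T q] gives [p ⊑ sat_hom u] for each pair [(p, q)] in
    [mu u]. *)
Lemma sat_hom_saturated u : saturated (sat_hom u).
Proof.
unfold saturated.
assert (H : tens_map (hom_id OM) sat_hom (mu M u) ⊑ inj1 OM OM (sat_hom u)).
{ rewrite hom_tens_leE; intros p q Hpq; rewrite tens_map_pure.
  apply le_trans with (pure p (guard (T q) (top OM))).
  { apply pure_mono; [apply le_refl | apply sat_hom_le_guard]. }
  refine (proj2 (bilinear_leE2 pure_bilinear p _ _) _); intros t [Tq ->].
  apply (pure_mono (A := OM) (B := OM)); [|apply le_refl].
  exact (proj1 (sat_hom_leE u (sat_hom u)) (le_refl _) p q Hpq Tq). }
refine (le_trans _ H).
(* Coassociativity: the left-hand side is [(id ⊗ id ⊗ T) ∘ (mu ⊗ id) ∘ mu]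
   and the right-hand side is [(id ⊗ id ⊗ T) ∘ (id ⊗ mu) ∘ mu]. *)
pose (k := tens_map (hom_id OM) (runit OM ∘ tens_map (hom_id OM) T)).
assert (E : tens_map (hom_id OM) sat_hom
  = k ∘ tens_map (hom_id OM) (mu M)).
{ apply tens_ext; intros a b; change
    (tens_map (hom_id OM) sat_hom (pure a b)
     = k (tens_map (hom_id OM) (mu M) (pure a b))).
  unfold k; now rewrite !tens_map_pure. }
rewrite E.
change (mu M (sat_hom u) ⊑ k ((tens_map (hom_id OM) (mu M) ∘ mu M) u)).
pose proof (f_equal (fun h : Hom OM (OM ⊗ (OM ⊗ OM)) => h u) (mu_assoc M)) as A.
refine (eq_ind _ (fun t => mu M (sat_hom u) ⊑ k t) _ _ A).
(* Contracting the last factor with [T] commutes with [mu] on the first. *)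
assert (E' : mu M ∘ (runit OM ∘ tens_map (hom_id OM) T)
  = k ∘ (assoc OM OM OM ∘ tens_map (mu M) (hom_id OM))).
{ apply tens_ext; intros a b.
  change (mu M (runit OM (tens_map (hom_id OM) T (pure a b)))
    = k (assoc OM OM OM (tens_map (mu M) (hom_id OM) (pure a b)))).
  rewrite !tens_map_pure, runit_pure.
  apply le_ext; intros z.
  refine (iff_trans (guard_hom (mu M) _ _ _) _).
  refine (iff_trans _ (iff_sym (hom_pure_l_leE (k ∘ assoc OM OM OM) _ _ _))).
  assert (P : forall x y, (k ∘ assoc OM OM OM) (pure (pure x y) (hom_id OM b)) =
    pure x (guard (T b) y)).
  { intros x y.
    change (k (assoc OM OM OM (pure (pure x y) b)) = pure x (guard (T b) y)).
    rewrite assoc_pure; unfold k; rewrite tens_map_pure.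
    change (pure x (runit OM (tens_map (hom_id OM) T (pure y b)))
      = pure x (guard (T b) y)).
    now rewrite tens_map_pure, runit_pure. }
  split.
  - intros H1 x y Hxy; rewrite P.
    refine (proj2 (bilinear_leE2 pure_bilinear x _ _) _); intros t [Tb ->].
    refine (le_trans _ (H1 Tb)); now apply pure_leE.
  - intros H1 Tb; apply tens_le_forall; intros x y Hxy.
    specialize (H1 x y Hxy); now rewrite P, guard_true in H1. }
pose proof (f_equal (fun h : Hom (OM ⊗ OM) (OM ⊗ OM) => h (mu M u)) E') as F.
exact (eq_ind _ (fun t => mu M (sat_hom u) ⊑ t) (le_refl _) _ F).
Qed.

(** The unit law expresses [u] with [eps1] in place of [T], and [eps1] lies below [T]. *)
Lemma le_sat_hom u : u ⊑ sat_hom u.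
Proof.
pose proof (f_equal (fun h : Hom OM OM => h u) (mu_unit_r M)) as E.
change ((runit OM ∘ tens_map (hom_id OM) (eps1 M)) (mu M u) = u) in E.
rewrite <- E at 1; rewrite hom_tens_leE; intros a b Hab.
change (runit OM (tens_map (hom_id OM) (eps1 M) (pure a b)) ⊑ sat_hom u).
rewrite tens_map_pure, runit_pure, guard_leE; intros He.
apply (proj1 (sat_hom_leE u (sat_hom u)) (le_refl _) a b Hab).
exact (@le_top (hom_sup OM Omega) (eps1 M) b He).
Qed.

Lemma sat_hom_id s : saturated s -> sat_hom s = s.
Proof.
intros Hs; apply le_antisym; [|apply le_sat_hom].
apply sat_hom_leE; intros a b Hab Tb.
apply Hs in Hab.
(* Saturation puts [(a, b)] in [inj1 s], the closure of the single pair [(s, top)], where the claim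
   is trivial. *)
enough (K : closed (fun a b => T b -> a ⊑ s)).
{ revert a b Hab Tb; apply (closure_min K); now intros a b [-> _] _; apply le_refl. }
exact (closed_imp_le1 T (hom_id OM) s).
Qed.

(** On [pure a b] both sides give [W a /\ T b], since [W] commutes with the action of truth
    values. *)
Lemma conv_top (W : Hom OM Omega) : conv W T = W ∘ sat_hom.
Proof.
unfold conv, sat_hom.
enough (E : Delta ∘ tens_map W T = W ∘ (runit OM ∘ tens_map (hom_id OM) T)).
{ apply hom_ext; intros u.
  exact (f_equal (fun h : Hom (OM ⊗ OM) Omega => h (mu M u)) E). }
apply tens_ext; intros a b.
change (Delta (tens_map W T (pure a b))
  = W (runit OM (tens_map (hom_id OM) T (pure a b)))).
unfold Delta; rewrite !tens_map_pure, tens_lift_pure, runit_pure, hom_guard_prop.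
apply (@le_antisym Omega); simpl; tauto.
Qed.

(** * Monoid ideals as maps out of the saturated opens *)

Definition sat_incl : Hom (sat_frame M) OM.
Proof.
refine (@mk_hom (sat_frame M) OM (@sval M) _); intros S z.
exact (join_image_leE (@sval M) S z).
Defined.

Definition sat_retr : Hom OM (sat_frame M).
Proof.
refine (@mk_hom OM (sat_frame M) (fun u => MkSat (@sat_hom_saturated u)) _).
intros S z; exact (hom_leE sat_hom S (sval z)).
Defined.

Lemma ideal_of_hom_prop (g : Hom (sat_frame M) Omega) : monoid_ideal (g ∘ sat_retr).
Proof.
unfold monoid_ideal; fold T; rewrite conv_top; apply hom_ext; intros u.
change (g (sat_retr u) = g (sat_retr (sat_hom u))); apply f_equal, sat_ext.
exact (eq_sym (sat_hom_id (@sat_hom_saturated u))).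
Qed.

Definition ideal_of_hom : Hom (hom_sup (sat_frame M) Omega) (ideal_sup M).
Proof.
refine (@mk_hom (hom_sup (sat_frame M) Omega) (ideal_sup M)
  (fun g => MkIdeal (ideal_of_hom_prop g)) _).
intros S z; split.
- intros H g Hg u Hu; apply (H u); exists (g (sat_retr u)).
  split; [now exists g | exact Hu].
- intros H u [p [[g [Hg <-]] Hu]]; exact (H g Hg u Hu).
Defined.

Definition hom_of_ideal : Hom (ideal_sup M) (hom_sup (sat_frame M) Omega).
Proof.
refine (@mk_hom (ideal_sup M) (hom_sup (sat_frame M) Omega)
  (fun I => ival I ∘ sat_incl) _).
intros F z; split.
- intros H I HI s Hs; apply (H s); exists (ival I (sval s)).
  split; [|exact Hs]; exists (ival I); split; [now exists I | reflexivity].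
- intros H s [p [[f [[I [HI <-]] <-]] Hs]]; exact (H I HI s Hs).
Defined.

Lemma ideal_of_homK : ideal_of_hom ∘ hom_of_ideal = hom_id (ideal_sup M).
Proof.
apply hom_ext; intros I; apply ideal_ext.
change (ival I ∘ sat_incl ∘ sat_retr = ival I).
(* Only the right-hand [I] becomes [I · top], which is [I ∘ sat_hom]; inclusion after retraction is
   [sat_hom] by computation. *)
rewrite (ideal_prop I) at 2; fold T; rewrite conv_top; now apply hom_ext.
Qed.

Lemma hom_of_idealK :
  hom_of_ideal ∘ ideal_of_hom = hom_id (hom_sup (sat_frame M) Omega).
Proof.
apply hom_ext; intros g; apply hom_ext; intros s.
change (g (sat_retr (sat_incl s)) = g s); apply f_equal, sat_ext.
exact (sat_hom_id (@sat_prop M s)).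
Qed.

End Saturation.

Theorem corollary3p14 (M : CommLocMonoid) (hovert : overt (opens M))
  (hdual : dualisable (sat_frame M)) : is_dual (sat_frame M) (ideal_sup M).
Proof.
exact (is_dual_transport (ideal_of_homK hovert) (hom_of_idealK hovert)
  (dualisable_hom hdual)).
Qed.
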